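(* Let $Q\in\mathbb{R}[X_1,\dots,X_n]$ be homogeneous of degree $d$, let $N\ge d$, let $p$ be a distribution on $[n]$, and let $S$ be a multiset of $N$ independent samples from $p$. Then \[ \mathbb{E}\big[(U_NQ(\Phi_S))^2\big]=\sum_{\substack{s\in\mathbb{N}^n\\ \|s\|\le d}}p^s\left(\frac{\partial^{\|s\|}Q}{\partial X_1^{s_1}\cdots\partial X_n^{s_n}}(p)\right)^2\frac{(N-d)!^2}{N!\,(N-2d+\|s\|)!\,\prod_{i=1}^ns_i!}. \]
   Context: The fingerprint $\Phi_S\in\mathbb{N}^n$ has $\Phi_{S,i}$ = number of occurrences of $i$ in $S$. For $s\in\mathbb{N}^n$: $\|s\|=\sum_is_i$, $p^s=\prod_ip_i^{s_i}$. For $Q=\sum_{\|\alpha\|=d}c_\alpha X^\alpha$ ($X^\alpha=\prod_iX_i^{\alpha_i}$), $U_NQ(\Phi_S)=\sum_\alpha c_\alpha\frac{\alpha_1!\cdots\alpha_n!(N-\|\alpha\|)!}{N!}\prod_{i=1}^n\binom{\Phi_{S,i}}{\alpha_i}$, an unbiased estimator of $Q(p)$. Convention: $1/k!=0$ for negative integers $k$. *)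

(* Defs.v *)
From HB Require Import structures.
From mathcomp Require Import all_boot all_order all_algebra.
From mathcomp Require Import finmap multiset.
From mathcomp Require Import all_classical all_reals all_analysis.
(* The notations of [mpoly] clash with those of MathComp-Analysis. *)
From mathcomp Require Import -(notations) mpoly.

Set Implicit Arguments.
Unset Strict Implicit.
Unset Printing Implicit Defensive.

Import Order.TTheory GRing.Theory Num.Theory.

Local Open Scope mset_scope.
Local Open Scope classical_set_scope.
Local Open Scope ring_scope.

Definition is_prob (R : realType) (n : nat) (p : 'I_n -> R) : Prop :=
  (forall i, 0 <= p i) /\ \sum_(i < n) p i = 1.

(* 'I_n carries the discrete sigma-algebra.  It has no [measurableType]
   instance in the library, which would require 'I_n to be pointed, so
   measurability is spelled out on preimages. *)
Record iid_sample d (T : measurableType d) (R : realType)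
    (P : probability T R) (n N : nat) (p : 'I_n -> R)
    (X : 'I_N -> T -> 'I_n) : Prop := IidSample {
  sample_measurable : forall (j : 'I_N) (A : set 'I_n),
    measurable (X j @^-1` A) ;
  sample_law : forall (j : 'I_N) (i : 'I_n),
    P (X j @^-1` [set i]) = (p i)%:E ;
  sample_independent : forall (J : {set 'I_N}) (A : 'I_N -> set 'I_n),
    P (\bigcap_(j in [set` J]) (X j @^-1` A j))
    = (\prod_(j in J) P (X j @^-1` A j))%E }.

Definition sample_mset (T : Type) (n N : nat) (X : 'I_N -> T -> 'I_n) (w : T)
    : {mset 'I_n} :=
  seq_mset [seq X j w | j <- enum 'I_N].

Definition fingerprint (n : nat) (S : {mset 'I_n}) : 'I_n -> nat :=
  fun i => S i.

(* The subtraction (N - ||a||) is truncated; only ||a|| <= N is meaningful. *)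
Definition U_est (R : realType) (n N : nat) (Q : mpoly n R) (phi : 'I_n -> nat)
    : R :=
  \sum_(a <- msupp Q)
    mcoeff a Q
    * (((\prod_(i < n) (a i)`!) * (N - mdeg a)`!)%:R / N`!%:R)
    * (\prod_(i < n) 'C(phi i, a i))%:R.

(* 1 / k!, extended by 0 to negative k. *)
Definition inv_fact (R : realType) (k : int) : R :=
  match k with
  | Posz m => m`!%:R^-1
  | Negz _ => 0
  end.

(* Main.v *)
(* In terms of falling factorials, [U_N X^a = (N-d)!/N! prod_i Phi_i^_(a_i)].
   The Vandermonde identity linearises the products
   [x^_a x^_b = sum_s C(a,s) b^_s x^_(a+b-s)], and the factorial moments of the
   multinomial distribution are [E prod_i Phi_i^_(c_i) = N^_|c| p^c], as seen by
   applying [d^c] to [(sum_i p_i X_i)^N = sum_t prod_j p_(t_j) X_(t_j)] at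
   [X = (1,...,1)].  Since [d^s X^a = prod_i a_i^_(s_i) X^(a-s)], the
   coefficient of [s] in [E(U_N X^a U_N X^b)] factors as [d^s X^a(p) d^s X^b(p)]
   times a quantity depending only on [s], and the claim follows by bilinearity. *)
Require Import Defs.
From HB Require Import structures.
From mathcomp Require Import all_boot all_order all_algebra.
From mathcomp Require Import finmap multiset.
From mathcomp Require Import all_classical all_reals all_analysis.
From mathcomp Require Import -(notations) mpoly.
From mathcomp Require Import ring.

Set Implicit Arguments.
Unset Strict Implicit.
Unset Printing Implicit Defensive.

Import Order.TTheory GRing.Theory Num.Theory.

Local Open Scope ring_scope.

(** * Products of falling factorials *)

Lemma ffactnD n a b : (n ^_ (a + b) = n ^_ a * (n - a) ^_ b)%N.
Proof.
by elim: b => [|b IHb]; rewrite ?addn0 ?muln1 // addnS !ffactnSr IHb subnDA mulnA.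
Qed.

(** Write [x ^_ b] as [b! C(x, b)], apply Vandermonde to [x = a + (x - a)], then recombine [x ^_ a]
    with [(x - a) ^_ (b - s)]. The bound [d] in place of [b] makes the range uniform over all
    coordinates; terms with [s > b] vanish through [b ^_ s]. *)
Lemma ffact_mul x a b d : (b <= d)%N ->
  (x ^_ a * x ^_ b =
   \sum_(s < d.+1) 'C(a, s) * b ^_ s * x ^_ (a + b - s))%N.
Proof.
move=> le_bd; have [lt_xa|le_ax] := ltnP x a.
  (* For [x < a] both sides are zero: on the right either [s > b] and [b ^_ s = 0], or
     [a + b - s >= a > x]. *)
  rewrite ffact_small // mul0n big1 // => s _.
  have [lt_bs|le_sb] := ltnP b s; first by rewrite (ffact_small lt_bs) muln0.
  by rewrite (@ffact_small x (a + b - s)) ?muln0 // -addnBA // ltn_addr.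
have -> : (x ^_ b = b`! * 'C(x, b))%N by rewrite mulnC bin_ffact.
rewrite -[in 'C(x, b)](subnKC le_ax) -binomial.Vandermonde.
rewrite (big_ord_widen d.+1 (fun s => 'C(a, s) * 'C(x - a, b - s))%N) //.
rewrite big_mkcond /= mulnA big_distrr /=.
apply: eq_bigr => s _; rewrite ltnS; case: leqP => [le_sb | lt_bs]; last first.
  by rewrite (ffact_small lt_bs) !muln0.
rewrite -addnBA // ffactnD -(bin_ffact (x - a)) -(ffact_fact le_sb).
ring.
Qed.

Lemma ffact_prod_mul n d (x : 'I_n -> nat) (a b : multinom n) :
  (mdeg b <= d)%N ->
  (\prod_(i < n) (x i ^_ a i * x i ^_ b i) =
   \sum_(s : bmultinom n d.+1)
     \prod_(i < n) ('C(a i, s i) * b i ^_ s i * x i ^_ (a i + b i - s i)))%N.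
Proof.
move=> le_bd; have le_b i : (b i <= d)%N.
  by apply: leq_trans le_bd; rewrite mdegE (bigD1 i) //= leq_addr.
under eq_bigr => i _ do rewrite (ffact_mul _ _ (le_b i)).
rewrite bigA_distr_bigA /=.
pose toM (f : {ffun 'I_n -> 'I_d.+1}) := Multinom [tuple (f i : nat) | i < n].
have toME f i : toM f i = f i by rewrite mnmE.
(* Distributivity gives a sum over all [f] with coordinates at most [d]. If [|f| > d >= |b|], some
   [f i > b i] and the term vanishes, which leaves the multi-indices of degree at most [d]. *)
rewrite (bigID (fun f => mdeg (toM f) < d.+1)%N) /= addnC big1 ?add0n; last first.
  move=> f; rewrite -leqNgt => lt_df.
  have [/forallP le_fb|] := boolP [forall i, (f i <= b i)%N].
    suff: (mdeg (toM f) <= d)%N by rewrite leqNgt lt_df.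
    by rewrite (leq_trans _ le_bd) // !mdegE leq_sum // => i _; rewrite toME.
  case/forallPn => i; rewrite -ltnNge => lt_bf.
  by rewrite (bigD1 i) //= (ffact_small lt_bf) muln0.
(* The degree bound on [s] bounds each coordinate by [d], so [inord] loses nothing and [h] inverts
   [toM] on the remaining terms. *)
pose h (s : bmultinom n d.+1) := [ffun i => inord (s i)] : {ffun 'I_n -> 'I_d.+1}.
have hE s i : h s i = s i :> nat.
  rewrite ffunE inordK // ltnS -ltnS (leq_trans _ (bmdeg s)) // ltnS.
  by rewrite mdegE (bigD1 i) //= leq_addr.
rewrite (reindex_onto h (fun f => insubd bm0 (toM f))) /=; last first.
  by move=> f lt_fd; apply/ffunP => i; apply: val_inj; rewrite /= hE val_insubd lt_fd toME.
apply: eq_big => [s|s _]; last by apply: eq_bigr => i _; rewrite hE.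
have -> : toM (h s) = s by apply/mnmP => i; rewrite toME hE.
by rewrite bmdeg valKd eqxx.
Qed.

(** * Factorial moments of the multinomial distribution *)

Lemma mderiv_linform_exp (R : comNzRingType) n (p : 'I_n -> R) i k :
  mderiv i ((\sum_j p j *: mpolyX R (mnm1 j)) ^+ k) =
  (k%:R * p i) *: (\sum_j p j *: mpolyX R (mnm1 j)) ^+ k.-1.
Proof.
set L := (\sum_j _); have dL : mderiv i L = mpolyC n (p i).
  rewrite raddf_sum (bigD1 i) //= big1 => [|j ne_ji].
    by rewrite mderivZ mderivX mnm1E eqxx -{1}[mnm1 i]add0m addmK mpolyX0 scale1r
      addr0 -mul_mpolyC mulr1.
  by rewrite mderivZ mderivX mnm1E (negPf ne_ji) scale0r scaler0.
elim: k => [|k IHk]; first by rewrite mderivC mul0r scale0r.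
rewrite exprS mderivM IHk dL mul_mpolyC -scalerAr.
case: k {IHk} => [|k]; first by rewrite !mul0r scale0r addr0 mul1r.
by rewrite -exprS -scalerDl -[in RHS]natr1 mulrDl mul1r addrC.
Qed.

(** Iterate the one-variable rule, first over the variables and then over the order in each of them.
    If [mdeg c > N], the falling factorial is zero and the truncated exponent is harmless. *)
Lemma mderivm_linform_exp (R : comNzRingType) n (p : 'I_n -> R) (c : multinom n) N :
  mderivm c ((\sum_j p j *: mpolyX R (mnm1 j)) ^+ N) =
  ((N ^_ mdeg c)%:R * \prod_(i < n) p i ^+ c i) *:
    (\sum_j p j *: mpolyX R (mnm1 j)) ^+ (N - mdeg c).
Proof.
have := mderiv_linform_exp p; set L := \sum_j _ => dL.
rewrite /mderivm mdegE -[index_enum _]enumT.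
elim: (enum 'I_n) => [|i s IHs] /=.
  by rewrite !big_nil subn0 mulr1 scale1r.
rewrite IHs !big_cons; elim: (c i) => [|k IHk] /=.
  by rewrite add0n mul1r.
rewrite IHk mderivZ dL scalerA addSn subnS ffactnSr natrM exprS.
by congr (_ *: _); ring.
Qed.

Lemma sum_prod_ffact (R : comNzRingType) n N (p : 'I_n -> R) (c : multinom n) :
  \sum_i p i = 1 ->
  \sum_(t : {ffun 'I_N -> 'I_n}) (\prod_j p (t j)) *
     (\prod_(i < n) (\sum_j (t j == i)) ^_ (c i))%:R
  = (N ^_ mdeg c)%:R * \prod_(i < n) p i ^+ c i.
Proof.
move=> p1; pose L := (\sum_j p j *: mpolyX R (mnm1 j)).
have L1 : meval (fun=> 1) L = 1.
  by rewrite raddf_sum /= -[RHS]p1; apply: eq_bigr => i _; rewrite mevalZ mevalXU mulr1.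
transitivity (meval (fun=> 1) (mderivm c (L ^+ N))); last first.
  by rewrite mderivm_linform_exp mevalZ rmorphXn /= L1 expr1n mulr1.
(* Expanded as a product over ['I_N], the power is a sum over sample sequences [t]; the exponent of
   the [i]-th variable in the monomial of [t] is the number of [j] with [t j = i]. *)
rewrite -[in RHS](card_ord N) -prodr_const bigA_distr_bigA /= !raddf_sum /=.
apply: eq_bigr => t _.
rewrite scaler_prod mprodXE mderivmZ mderivmX !mevalZ mevalX.
rewrite [X in _ = _ * (_ * X)]big1 ?mulr1 => [|i _]; last by rewrite expr1n.
congr (_ * _%:R); apply: eq_bigr => i _; rewrite mnm_sumE.
by congr (_ ^_ _); apply: eq_bigr => j _; rewrite mnm1E.
Qed.

Lemma sum_prod_ffact_mul (R : numFieldType) n d N (p : 'I_n -> R)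
    (a b : multinom n) :
  \sum_i p i = 1 -> mdeg a = d -> mdeg b = d ->
  \sum_(t : {ffun 'I_N -> 'I_n}) (\prod_j p (t j)) *
     ((\prod_(i < n) (\sum_j (t j == i)) ^_ (a i))%:R
      * (\prod_(i < n) (\sum_j (t j == i)) ^_ (b i))%:R)
  = \sum_(s : bmultinom n d.+1)
      (\prod_(i < n) p i ^+ s i) / (\prod_(i < n) (s i)`!)%:R
      * (N ^_ (2 * d - mdeg s))%:R
      * (meval p (mderivm s (mpolyX R a)) * meval p (mderivm s (mpolyX R b))).
Proof.
move=> p1 da db; under eq_bigr => t _.
  rewrite -natrM -big_split /= (@ffact_prod_mul _ d) ?db //.
  by rewrite natr_sum big_distrr /=; over.
rewrite exchange_big /=; apply: eq_bigr => s _.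
rewrite !mderivmX !mevalZ !mevalX.
have fact_neq0 : (\prod_(i < n) (s i)`!)%:R != 0 :> R.
  by rewrite pnatr_eq0 -lt0n prodn_gt0 // => i; rewrite fact_gt0.
(* Unless [s <= a] and [s <= b] coordinatewise, both sides vanish; past these cases the subtractions
   in [a + b - s] are exact. *)
have [/forallP le_sa|/forallPn[i]] := boolP [forall i, (s i <= a i)%N]; last first.
  rewrite -ltnNge => lt_as; rewrite [(\prod_i a i ^_ s i)%N](bigD1 i) //=.
  rewrite (ffact_small lt_as) mul0n !mul0r mulr0 big1 // => t _.
  by rewrite (bigD1 i) //= bin_small // !mul0n mulr0.
have [/forallP le_sb|/forallPn[i]] := boolP [forall i, (s i <= b i)%N]; last first.
  rewrite -ltnNge => lt_bs; rewrite [(\prod_i b i ^_ s i)%N](bigD1 i) //=.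
  rewrite (ffact_small lt_bs) mul0n !(mul0r, mulr0) big1 // => t _.
  by rewrite (bigD1 i) //= (ffact_small lt_bs) muln0 !mul0n mulr0.
pose c := mnm_sub (mnm_add a b) s.
have cE i : c i = (a i + b i - s i)%N by rewrite !mnmE.
have dc : mdeg c = (2 * d - mdeg s)%N.
  have -> : (2 * d = mdeg (mnm_add a b))%N by rewrite mdegD da db mul2n addnn.
  have -> : mnm_add a b = mnm_add c s.
    by apply/mnmP => i; rewrite !mnmDE cE subnK // (leq_trans (le_sa i)) ?leq_addr.
  by rewrite mdegD addnK.
under eq_bigr => t _.
  under [(\prod_i _)%N]eq_bigr => i _ do rewrite -cE.
  by rewrite big_split /= natrM mulrCA; over.
rewrite -big_distrr /= sum_prod_ffact // dc.
have -> : (\prod_i a i ^_ s i = (\prod_i 'C(a i, s i)) * \prod_i (s i)`!)%N.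
  by rewrite -big_split /=; apply: eq_bigr => i _; rewrite bin_ffact.
(* Splitting [c = s + (a - s) + (b - s)] separates the two derivatives at [p]; the factor [s!] from
   [a ^_ s] cancels the denominator. *)
have -> : \prod_i p i ^+ c i =
    \prod_i p i ^+ s i * \prod_i p i ^+ mnm_sub a s i * \prod_i p i ^+ mnm_sub b s i.
  rewrite -!big_split /=; apply: eq_bigr => i _; rewrite -!exprD cE !mnmE.
  by rewrite subnKC // addnBA.
rewrite big_split /= !natrM; field.
exact: fact_neq0.
Qed.

(** * The second moment as a finite sum *)

(** For [k > N] both sides are zero, so falling factorials already encode the convention for
    negative arguments. *)
Lemma inv_fact_sub (R : realType) (N k : nat) :
  inv_fact R (N%:Z - k%:Z) = (N ^_ k)%:R / N`!%:R.
Proof.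
have [le_kN|lt_Nk] := leqP k N.
  rewrite subzn //= -(ffact_fact le_kN) natrM invfM mulrA divff ?mul1r //.
  by rewrite pnatr_eq0 -lt0n ffact_gt0.
have -> : N%:Z - k%:Z = Negz (k - N.+1).
  by rewrite NegzE -subSn // subSS -(subzn (ltnW lt_Nk)) opprB.
by rewrite ffact_small // mul0r.
Qed.

Lemma U_est_homog (R : realType) n d N (Q : mpoly n R) (phi : 'I_n -> nat) :
  Q \is ishomog1 d mdeg ->
  U_est N Q phi = (N - d)`!%:R / N`!%:R *
    \sum_(a <- msupp Q) mcoeff a Q * (\prod_(i < n) phi i ^_ a i)%:R.
Proof.
move=> /dhomog_mf degQ; rewrite /U_est big_distrr /= [LHS]big_seq [RHS]big_seq.
apply: eq_bigr => a /degQ ->; rewrite natrM.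
have -> : (\prod_i phi i ^_ a i = (\prod_i (a i)`!) * \prod_i 'C(phi i, a i))%N.
  by rewrite -big_split /=; apply: eq_bigr => i _; rewrite mulnC bin_ffact.
by rewrite natrM; ring.
Qed.

Lemma meval_mderivm (R : comNzRingType) n (Q : mpoly n R) (s : multinom n)
    (p : 'I_n -> R) :
  meval p (mderivm s Q) =
  \sum_(a <- msupp Q) mcoeff a Q * meval p (mderivm s (mpolyX R a)).
Proof.
rewrite [in LHS](mpolyE Q) !raddf_sum /=.
by apply: eq_bigr => a _; rewrite mderivmZ mevalZ.
Qed.

Lemma sum_U_est_sqr (R : realType) n d N (Q : mpoly n R) (p : 'I_n -> R) :
  Q \is ishomog1 d mdeg -> \sum_i p i = 1 ->
  \sum_(t : {ffun 'I_N -> 'I_n}) (\prod_j p (t j)) *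
     U_est N Q (fun i => \sum_j (t j == i))%N ^+ 2
  = \sum_(s : bmultinom n d.+1)
     (\prod_(i < n) p i ^+ s i) * meval p (mderivm s Q) ^+ 2
     * ((N - d)`!%:R ^+ 2 / N`!%:R
        * inv_fact R (N%:Z - (2 * d)%:Z + (mdeg s)%:Z)
        / (\prod_(i < n) (s i)`!)%:R).
Proof.
move=> Qd p1; set r : R := (N - d)`!%:R / N`!%:R.
transitivity (\sum_(a <- msupp Q) \sum_(b <- msupp Q)
  r ^+ 2 * (mcoeff a Q * mcoeff b Q) * \sum_(t : {ffun 'I_N -> 'I_n})
   (\prod_j p (t j)) *
     ((\prod_(i < n) (\sum_j (t j == i)) ^_ (a i))%:R
      * (\prod_(i < n) (\sum_j (t j == i)) ^_ (b i))%:R)).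
  under [RHS]eq_bigr => a _ do under eq_bigr => b _ do rewrite big_distrr /=.
  under [RHS]eq_bigr => a _ do rewrite exchange_big /=.
  rewrite [RHS]exchange_big /=; apply: eq_bigr => t _.
  rewrite (U_est_homog _ _ Qd) -/r exprMn [(\sum_(_ <- _) _) ^+ 2]expr2.
  rewrite big_distrl !big_distrr /=; apply: eq_bigr => a _.
  by rewrite !big_distrr /=; apply: eq_bigr => b _; ring.
transitivity (\sum_(a <- msupp Q) \sum_(b <- msupp Q) \sum_(s : bmultinom n d.+1)
   r ^+ 2 * (mcoeff a Q * mcoeff b Q) *
   ((\prod_(i < n) p i ^+ s i) / (\prod_(i < n) (s i)`!)%:R
      * (N ^_ (2 * d - mdeg s))%:R
      * (meval p (mderivm s (mpolyX R a)) * meval p (mderivm s (mpolyX R b))))).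
  have degQ := dhomog_mf Qd.
  rewrite [LHS]big_seq [RHS]big_seq; apply: eq_bigr => a /degQ da.
  rewrite [LHS]big_seq [RHS]big_seq; apply: eq_bigr => b /degQ db.
  by rewrite (sum_prod_ffact_mul _ p1 da db) big_distrr.
(* With [s] outermost, the double sum over monomials [a], [b] factors for each [s] as the square of
   the derivative of [Q] at [p]. *)
under eq_bigr => a _ do rewrite exchange_big /=.
rewrite exchange_big /=; apply: eq_bigr => s _.
have le_sd : (mdeg s <= d)%N by rewrite -ltnS bmdeg.
have le_s2d : (mdeg s <= 2 * d)%N by rewrite mul2n -addnn (leq_trans le_sd) ?leq_addr.
have -> : N%:Z - (2 * d)%:Z + (mdeg s)%:Z = N%:Z - (2 * d - mdeg s)%N%:Z.
  by rewrite -(subzn le_s2d) opprB addrCA addrC.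
rewrite inv_fact_sub meval_mderivm [(\sum_(_ <- _) _) ^+ 2]expr2 /r.
rewrite big_distrlr big_distrr big_distrl /=; apply: eq_bigr => a _.
rewrite big_distrr big_distrl /=; apply: eq_bigr => b _.
by ring.
Qed.

(** * From the probability space to sample sequences *)

Lemma fingerprint_sample_mset (T : Type) n N (X : 'I_N -> T -> 'I_n) w :
  fingerprint (sample_mset X w) = (fun i => \sum_j (X j w == i))%N.
Proof.
apply/funext => i; rewrite /fingerprint /sample_mset mset_seqE count_map.
by rewrite -sum1_count big_mkcond /= big_enum.
Qed.

Lemma iid_sample_joint_law d (T : measurableType d) (R : realType)
    (P : probability T R) n N (p : 'I_n -> R) (X : 'I_N -> T -> 'I_n)
    (t : {ffun 'I_N -> 'I_n}) :
  iid_sample P p X ->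
  P (\bigcap_j (X j @^-1` [set t j]))%classic = (\prod_j p (t j))%:E.
Proof.
move=> [mX lawX indX].
have := indX [set: 'I_N] (fun j => [set t j])%classic.
have -> : [set` [set: 'I_N]%SET]%classic = setT by apply/seteqP; split => j //=; rewrite inE.
move=> ->; rewrite -prodEFin; apply: eq_big => [j|j _]; first by rewrite inE.
exact: lawX.
Qed.

Lemma expectation_iid_sample d (T : measurableType d) (R : realType)
    (P : probability T R) n N (p : 'I_n -> R) (X : 'I_N -> T -> 'I_n)
    (f : {ffun 'I_N -> 'I_n} -> R) :
  iid_sample P p X ->
  ('E_P[fun w => f [ffun j => X j w]] = 
   (\sum_(t : {ffun 'I_N -> 'I_n}) (\prod_j p (t j)) * f t)%:E)%E.
Proof.
move=> X_iid; have [mX _ _] := X_iid; rewrite unlock.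
pose A (t : {ffun 'I_N -> 'I_n}) : set T := (\bigcap_j (X j @^-1` [set t j]))%classic.
have mA t : measurable (A t) by apply: fin_bigcap_measurable.
(* The events [A t] partition the space, so a function of the samples is a finite combination of
   their indicators and linearity of the integral applies. *)
have -> : (fun w => (f [ffun j => X j w])%:E) =
    (fun w => \sum_t ((f t)%:E * (\1_(A t) w)%:E))%E.
  apply/funext => w; rewrite (bigD1 [ffun j => X j w]) //= big1 ?adde0 => [|t ne_t].
    rewrite indicE mem_set ?mule1 // => j _ /=.
    by rewrite ffunE.
  rewrite indicE memNset ?mule0 // => At; case/eqP: ne_t.
  by apply/ffunP => j; rewrite ffunE; rewrite -(At j).
have iA t := integrable_indic P (mA t).
rewrite integral_sum //= => [|t]; last exact: integrableZl.
rewrite -sumEFin; apply: eq_bigr => t _.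
rewrite integralZl // integral_indic // setIT.
by rewrite EFinM muleC -(iid_sample_joint_law t X_iid).
Qed.

Theorem theorem4p6 (R : realType) (n d N : nat) (Q : mpoly n R)
    (Q_homog : Q \is ishomog1 d mdeg) (leq_dN : (d <= N)%N)
    (p : 'I_n -> R) (p_prob : is_prob p)
    (disp : measure_display) (T : measurableType disp) (P : probability T R)
    (X : 'I_N -> T -> 'I_n) (X_iid : iid_sample P p X) :
  ('E_P[fun w => (U_est N Q (fingerprint (sample_mset X w)) ^+ 2)%R])%E =
  (\sum_(s : bmultinom n d.+1)
     (\prod_(i < n) p i ^+ s i) * meval p (mderivm s Q) ^+ 2
     * ((N - d)`!%:R ^+ 2 / N`!%:R
        * inv_fact R (N%:Z - (2 * d)%:Z + (mdeg s)%:Z)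
        / (\prod_(i < n) (s i)`!)%:R))%:E.
Proof.
(* Both sides become the average over sample sequences of the squared estimator, taken at the vector
   of counts. *)
rewrite -sum_U_est_sqr //; last by case: p_prob.
rewrite -(expectation_iid_sample _ X_iid); congr expectation; apply/funext => w.
rewrite fingerprint_sample_mset; congr (U_est _ _ _ ^+ 2); apply/funext => i.
by apply: eq_bigr => j _; rewrite ffunE.
Qed.
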